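(* For all reals $a,b\in\mathcal{P}(\omega)$ and every finite tuple $\overline{c}$ of reals the following hold. (i) $\neg\mathsf{Tp}(a,\overline{c})\ \&\ b\leq_T a\ \Rightarrow\ \neg\mathsf{Tp}(b,\overline{c})$. (Equivalently: $\mathsf{Tp}(b,\overline{c})\ \&\ b\leq_T a\ \Rightarrow\ \mathsf{Tp}(a,\overline{c})$.) (ii) $\mathsf{Tp}(a,\overline{c})\ \&\ b\equiv_T a\ \Rightarrow\ \mathsf{Tp}(b,\overline{c})$. (iii) $\mathsf{Tp}(a,\overline{c})\ \Leftrightarrow\ \mathsf{Tp}(a',\overline{c})$, where $a'=\{e\in\omega:\Phi_e^a(e)\downarrow\}$ is the halting problem relative to $a$.
   Context: Reals are elements of $\mathcal{P}(\omega)$. $\mathcal{R}=(\omega,\mathcal{P}(\omega),+,\cdot,<,\in,0,1)$ is the full standard model of second-order arithmetic, in the two-sorted language $L_2=\{+,\cdot,<,\in,0,1\}$. For a real $a$ and a finite tuple $\overline{c}$ of reals, $\mathsf{Tp}(a,\overline{c})$ (''$a$ is $\overline{c}$-typical'') means: for every $L_2$-formula $\phi(x,\overline{y})$ (with $x$, $\overline{y}$ ranging over reals) such that $\mathcal{R}\models\phi(a,\overline{c})$, $|\{x\in\mathcal{P}(\omega):\mathcal{R}\models\phi(x,\overline{c})\}|=2^{\aleph_0}$. $\leq_T$ is Turing reducibility, $\equiv_T$ is Turing equivalence, and $\Phi_e^a$ is the $e$-th partial computable function with oracle $a$. *)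

(* Defs.v *)
From mathcomp Require Import all_boot.
From mathcomp Require Import boolp classical_sets functions cardinality.

Set Implicit Arguments.
Unset Strict Implicit.
Unset Printing Implicit Defensive.

Local Open Scope classical_set_scope.
Local Open Scope card_scope.
Local Open Scope nat_scope.

(* L_2-formulas are well scoped by construction: [formula n m] has its free
   number variables among [n] and its free set variables among [m] de Bruijn
   indices, the most recently bound variable having index [ord0]. Equality is a
   logical symbol, available at both sorts. *)

Inductive term (n : nat) : Type :=
| Var of 'I_n
| Zero
| One
| Add of term n & term n
| Mul of term n & term n.

Inductive formula (n m : nat) : Type :=
| EqN of term n & term n
| EqS of 'I_m & 'I_m
| Lt of term n & term n
| Mem of term n & 'I_m
| Not of formula n m
| And of formula n m & formula n m
| Or of formula n m & formula n m
| Imp of formula n m & formula n m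
| AllN of formula n.+1 m
| ExN of formula n.+1 m
| AllS of formula n m.+1
| ExS of formula n m.+1.

Fixpoint eval n (v : n.-tuple nat) (t : term n) : nat :=
  match t with
  | Var i => tnth v i
  | Zero => 0
  | One => 1
  | Add t u => eval v t + eval v u
  | Mul t u => eval v t * eval v u
  end.

(* Satisfaction in the full standard model (omega, P(omega)). *)
Fixpoint sat n m (phi : formula n m) :
    n.-tuple nat -> m.-tuple (set nat) -> Prop :=
  match phi with
  | EqN t u => fun v _ => eval v t = eval v u
  | EqS X Y => fun _ V => tnth V X = tnth V Y
  | Lt t u => fun v _ => eval v t < eval v u
  | Mem t X => fun v V => tnth V X (eval v t)
  | Not p => fun v V => ~ sat p v V
  | And p q => fun v V => sat p v V /\ sat q v V
  | Or p q => fun v V => sat p v V \/ sat q v V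
  | Imp p q => fun v V => sat p v V -> sat q v V
  | AllN p => fun v V => forall k : nat, sat p [tuple of k :: v] V
  | ExN p => fun v V => exists k : nat, sat p [tuple of k :: v] V
  | AllS p => fun v V => forall X : set nat, sat p v [tuple of X :: V]
  | ExS p => fun v V => exists X : set nat, sat p v [tuple of X :: V]
  end.

Definition definable_set k (phi : formula 0 k.+1) (c : k.-tuple (set nat)) :
    set (set nat) :=
  [set x | sat phi [tuple] [tuple of x :: c]].

Definition Tp (a : set nat) k (c : k.-tuple (set nat)) : Prop :=
  forall phi : formula 0 k.+1, definable_set phi c a ->
    definable_set phi c #= [set: set nat].

(* Oracle computation is by unlimited register machines with an oracle
   (Shepherdson-Sturgis, Cutland). Registers and instructions are numbered
   from 0; the machine halts when the instruction counter leaves the program;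
   register 0 holds the input at the start and the output at the end. *)

Inductive instr : Type :=
| Zeroing of nat             (* r_i := 0 *)
| Succ of nat                (* r_i := r_i + 1 *)
| Transfer of nat & nat      (* r_j := r_i *)
| Jump of nat & nat & nat    (* if r_i = r_j then go to instruction q *)
| Query of nat.              (* r_i := 1 if r_i is in the oracle, else 0 *)

Definition config : Type := (nat * (nat -> nat))%type.

Definition set_reg (r : nat -> nat) (i x : nat) : nat -> nat :=
  fun j => if j == i then x else r j.

Definition step (a : set nat) (p : seq instr) (s : config) : config :=
  let: (pc, r) := s in
  match onth p pc with
  | None => s
  | Some (Zeroing i) => (pc.+1, set_reg r i 0)
  | Some (Succ i) => (pc.+1, set_reg r i (r i).+1)
  | Some (Transfer i j) => (pc.+1, set_reg r j (r i))
  | Some (Jump i j q) => (if r i == r j then q else pc.+1, r)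
  | Some (Query i) => (pc.+1, set_reg r i (nat_of_bool (r i \in a)))
  end.

Definition init (n : nat) : config := (0, set_reg (fun=> 0) 0 n).

Definition computes (a : set nat) (p : seq instr) (n m : nat) : Prop :=
  exists t : nat, let s := iter t (step a p) (init n) in
    size p <= s.1 /\ s.2 0 = m.

Definition code_instr (i : instr) : nat :=
  CodeSeq.code
    match i with
    | Zeroing i => [:: 0; i]
    | Succ i => [:: 1; i]
    | Transfer i j => [:: 2; i; j]
    | Jump i j q => [:: 3; i; j; q]
    | Query i => [:: 4; i]
    end.

Definition code_prog (p : seq instr) : nat :=
  CodeSeq.code (map code_instr p).

Lemma code_instr_inj : injective code_instr.
Proof.
move=> i j /(can_inj CodeSeq.codeK).
by case: i => [x|x|x y|x y z|x]; case: j => [x'|x'|x' y'|x' y' z'|x'] //;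
  case=> *; subst.
Qed.

Lemma code_prog_inj : injective code_prog.
Proof.
by move=> p q /(can_inj CodeSeq.codeK) /(inj_map code_instr_inj).
Qed.

(* [Phi e a] is the graph of the e-th partial function computable with oracle
   [a]; it is empty when [e] is not the code of a program. *)
Definition Phi (e : nat) (a : set nat) (n m : nat) : Prop :=
  exists2 p : seq instr, code_prog p = e & computes a p n m.

Lemma Phi_functional e a n m m' : Phi e a n m -> Phi e a n m' -> m = m'.
Proof.
move=> [p <- [t [ht <-]]] [q /code_prog_inj -> [t' [ht' <-]]].
have stop s u : size p <= s.1 -> iter u (step a p) s = s.
  case: s => pc r /= hs; elim: u => //= u ->.
  by rewrite /= onth_default.
wlog le_tt' : t t' ht ht' / t <= t'.
  move=> W; case: (leqP t t') => [|/ltnW] h; first exact: W.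
  by apply/esym/W.
by rewrite -(subnK le_tt') iterD (stop _ _ ht).
Qed.

Definition turing_le (b a : set nat) : Prop :=
  exists e : nat, forall n : nat, Phi e a n (nat_of_bool (n \in b)).

Definition turing_eq (b a : set nat) : Prop := turing_le b a /\ turing_le a b.

Definition jump (a : set nat) : set nat :=
  [set e | exists m : nat, Phi e a e m].

(* Main.v *)
Require Import Defs.
From mathcomp Require Import all_boot.
From mathcomp Require Import boolp classical_sets functions cardinality.
From mathcomp Require Import zify.

(** All three parts follow from one transfer principle, [Tp_transfer].  Let [G]
be the graph of a partial function on reals that is definable without
parameters, let [G a b], and suppose that [b] is typical over [c].  If [phi]
holds of [a] and [c], then [b] belongs to the image under [G] of the set that
[phi] defines.  That image is definable from [c], so typicality of [b] gives it
size continuum; a set has at least the size of its image, so the set defined by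
[phi] has size continuum too.  Hence [a] is typical over [c].

Applied to the graph of [fun x => Phi e x], this shows that typicality passes
upward along Turing reducibility, which is (i) and (ii).  Applied to
[y = jump x], it shows that [a] is typical whenever [jump a] is.  The converse
is the same principle applied to the inverse relation [x = jump y], which is
functional because the jump is injective: for every [n] there is a program that
ignores its input and halts exactly when [n] is in the oracle, so the jump of
[a] determines [a].

It remains to see that [Phi e a n m] is expressible in second-order arithmetic,
uniformly in its arguments.  Formulas are never written by hand: a predicate on
environments is called definable when some formula expresses it, and this
notion is shown to be closed under logical operations and substitution.  A real
codes a function on the natural numbers through a polynomial pairing function,
so quantification over functions comes for free, and every recursion is
expressed as the existence of a function that satisfies the recursion
equations.  In this way exponentiation, the coding of programs and whole
computation histories become definable ([PhiE], [definable_Phi]). *)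

Set Implicit Arguments.
Unset Strict Implicit.
Unset Printing Implicit Defensive.

Local Open Scope classical_set_scope.
Local Open Scope card_scope.
Local Open Scope nat_scope.

(** * Environments and definable predicates *)

Definition env n m : Type := (n.-tuple nat * m.-tuple (set nat))%type.

Definition pushN n m (x : nat) (s : env n m) : env n.+1 m :=
  ([tuple of x :: s.1], s.2).
Definition pushS n m (X : set nat) (s : env n m) : env n m.+1 :=
  (s.1, [tuple of X :: s.2]).
Definition topN n m (s : env n.+1 m) : nat := thead s.1.
Definition topS n m (s : env n m.+1) : set nat := thead s.2.
Definition popN n m (s : env n.+1 m) : env n m := ([tuple of behead s.1], s.2).
Definition popS n m (s : env n m.+1) : env n m := (s.1, [tuple of behead s.2]).

Lemma topN_push n m x (s : env n m) : topN (pushN x s) = x.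
Proof. by []. Qed.

Lemma topS_push n m X (s : env n m) : topS (pushS X s) = X.
Proof. by []. Qed.

Lemma popN_push n m x (s : env n m) : popN (pushN x s) = s.
Proof. by case: s => v V; congr pair; apply: val_inj. Qed.

Lemma popS_push n m X (s : env n m) : popS (pushS X s) = s.
Proof. by case: s => v V; congr pair; apply: val_inj. Qed.

Lemma pushN_pop n m (s : env n.+1 m) : pushN (topN s) (popN s) = s.
Proof. by case: s => v V; rewrite /pushN/= -tuple_eta. Qed.

Definition definable n m (P : env n m -> Prop) : Prop :=
  exists phi : formula n m, forall s, sat phi s.1 s.2 <-> P s.

(** The graph is read in an environment whose most recent number variable is the
value, so that substituting a definable function is one number quantifier. *)
Definition definable_fun n m (f : env n m -> nat) : Prop :=
  definable (fun s : env n.+1 m => topN s = f (popN s)).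

Definition varN n m (x : env n m -> nat) : Prop :=
  exists i, forall s, x s = tnth s.1 i.

Definition varS n m (X : env n m -> set nat) : Prop :=
  exists i, forall s, X s = tnth s.2 i.

Lemma definable_ext n m (P Q : env n m -> Prop) :
  definable P -> (forall s, P s <-> Q s) -> definable Q.
Proof.
move=> [phi hphi] PQ; exists phi => s.
by split=> [/hphi/PQ|/PQ/hphi].
Qed.

(** * Renaming of variables *)

Definition lift_var n n' (f : 'I_n -> 'I_n') (i : 'I_n.+1) : 'I_n'.+1 :=
  if unlift ord0 i is Some j then lift ord0 (f j) else ord0.

Fixpoint rename_term n n' (f : 'I_n -> 'I_n') (t : term n) : term n' :=
  match t with
  | Var i => Var (f i)
  | Zero => Zero _
  | One => One _
  | Add t u => Add (rename_term f t) (rename_term f u)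
  | Mul t u => Mul (rename_term f t) (rename_term f u)
  end.

(** Renaming, rather than just weakening, is what lets the value variable of a
graph move past newly bound variables. *)
Fixpoint rename_formula n m (phi : formula n m) :
    forall n' m', ('I_n -> 'I_n') -> ('I_m -> 'I_m') -> formula n' m' :=
  match phi with
  | EqN t u => fun _ _ f g => EqN _ (rename_term f t) (rename_term f u)
  | EqS X Y => fun _ _ f g => EqS _ (g X) (g Y)
  | Lt t u => fun _ _ f g => Lt _ (rename_term f t) (rename_term f u)
  | Defs.Mem t X => fun _ _ f g => Defs.Mem (rename_term f t) (g X)
  | Not p => fun _ _ f g => Not (rename_formula p f g)
  | And p q => fun _ _ f g => And (rename_formula p f g) (rename_formula q f g)
  | Or p q => fun _ _ f g => Or (rename_formula p f g) (rename_formula q f g)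
  | Imp p q => fun _ _ f g => Imp (rename_formula p f g) (rename_formula q f g)
  | AllN p => fun _ _ f g => AllN (rename_formula p (lift_var f) g)
  | ExN p => fun _ _ f g => ExN (rename_formula p (lift_var f) g)
  | AllS p => fun _ _ f g => AllS (rename_formula p f (lift_var g))
  | ExS p => fun _ _ f g => ExS (rename_formula p f (lift_var g))
  end.

Lemma tnth_lift_var T n n' (f : 'I_n -> 'I_n') (x : T)
    (v : n.-tuple T) (w : n'.-tuple T) :
  (forall i, tnth w (f i) = tnth v i) ->
  forall i, tnth [tuple of x :: w] (lift_var f i) = tnth [tuple of x :: v] i.
Proof.
move=> h i; rewrite /lift_var; case: unliftP => [j ->|->].
  by rewrite !tnthS h.
by rewrite !tnth0.
Qed.

Lemma eval_rename n n' (f : 'I_n -> 'I_n') v w (t : term n) :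
  (forall i, tnth w (f i) = tnth v i) -> eval w (rename_term f t) = eval v t.
Proof. by move=> h; elim: t => //= t -> u ->. Qed.

Lemma sat_rename n m (phi : formula n m) :
  forall n' m' (f : 'I_n -> 'I_n') (g : 'I_m -> 'I_m') v V w W,
  (forall i, tnth w (f i) = tnth v i) -> (forall i, tnth W (g i) = tnth V i) ->
  sat (rename_formula phi f g) w W <-> sat phi v V.
Proof.
elim: {n m} phi => /=
  [n m t u|n m X Y|n m t u|n m t X|n m p IHp|n m p IHp q IHq|n m p IHp q IHq
  |n m p IHp q IHq|n m p IHp|n m p IHp|n m p IHp|n m p IHp] n' m' f g v V w W hf hg.
- by rewrite !(eval_rename _ hf).
- by rewrite !hg.
- by rewrite !(eval_rename _ hf).
- by rewrite !(eval_rename _ hf) hg.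
- by rewrite (IHp _ _ _ _ _ _ _ _ hf hg).
- by rewrite (IHp _ _ _ _ _ _ _ _ hf hg) (IHq _ _ _ _ _ _ _ _ hf hg).
- by rewrite (IHp _ _ _ _ _ _ _ _ hf hg) (IHq _ _ _ _ _ _ _ _ hf hg).
- by rewrite (IHp _ _ _ _ _ _ _ _ hf hg) (IHq _ _ _ _ _ _ _ _ hf hg).
- by split=> h k; apply/(IHp _ _ _ _ _ _ _ _ (tnth_lift_var k hf) hg).
- by split=> -[k h]; exists k; apply/(IHp _ _ _ _ _ _ _ _ (tnth_lift_var k hf) hg).
- by split=> h k; apply/(IHp _ _ _ _ _ _ _ _ hf (tnth_lift_var k hg)).
- by split=> -[k h]; exists k; apply/(IHp _ _ _ _ _ _ _ _ hf (tnth_lift_var k hg)).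
Qed.

(** The semantic counterpart of renaming: every variable of [r s] is a variable
of [s].  Composites of [popN] and [popS], which is how bound variables shift
the context, are of this form. *)
Definition reindexing n m n' m' (r : env n' m' -> env n m) : Prop :=
  (exists f, forall s i, tnth s.1 (f i) = tnth (r s).1 i) /\
  (exists g, forall s i, tnth s.2 (g i) = tnth (r s).2 i).

Section Reindexing.
Context {n m n' m' : nat} {r : env n' m' -> env n m}.
Hypothesis hr : reindexing r.

Lemma definable_reindex (P : env n m -> Prop) :
  definable P -> definable (fun s => P (r s)).
Proof.
case: hr => -[f hf] [g hg] [phi hphi]; exists (rename_formula phi f g) => s.
rewrite -hphi; apply: sat_rename; [exact: hf|exact: hg].
Qed.

Lemma varN_reindex (x : env n m -> nat) : varN x -> varN (fun s => x (r s)).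
Proof.
by case: hr => -[f hf] _ [i hi]; exists (f i) => s; rewrite hi hf.
Qed.

Lemma varS_reindex (X : env n m -> set nat) : varS X -> varS (fun s => X (r s)).
Proof.
by case: hr => _ [g hg] [i hi]; exists (g i) => s; rewrite hi hg.
Qed.

Lemma reindexing_pushN (x : env n' m' -> nat) :
  varN x -> reindexing (fun s => pushN (x s) (r s)).
Proof.
case: hr => -[f hf] [g hg] [i hi]; split; last by exists g.
exists (fun j => if unlift ord0 j is Some j' then f j' else i) => s j.
by case: unliftP => [j' ->|->]; rewrite ?tnthS ?tnth0 ?hf ?hi.
Qed.

Lemma reindexing_pushS (X : env n' m' -> set nat) :
  varS X -> reindexing (fun s => pushS (X s) (r s)).
Proof.
case: hr => -[f hf] [g hg] [i hi]; split; first by exists f.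
exists (fun j => if unlift ord0 j is Some j' then g j' else i) => s j.
by case: unliftP => [j' ->|->]; rewrite ?tnthS ?tnth0 ?hg ?hi.
Qed.

End Reindexing.

Lemma reindexing_id n m : reindexing (fun s : env n m => s).
Proof. by split; exists id. Qed.

Lemma reindexing_popN n m n' m' (r : env n' m' -> env n.+1 m) :
  reindexing r -> reindexing (fun s => popN (r s)).
Proof.
move=> [[f hf] [g hg]]; split; last by exists g.
by exists (fun i => f (inord i.+1)) => s i; rewrite tnth_behead hf.
Qed.

Lemma reindexing_popS n m n' m' (r : env n' m' -> env n m.+1) :
  reindexing r -> reindexing (fun s => popS (r s)).
Proof.
move=> [[f hf] [g hg]]; split; first by exists f.
by exists (fun i => g (inord i.+1)) => s i; rewrite tnth_behead hg.
Qed.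

Lemma varN_topN n m : varN (@topN n m).
Proof. by exists ord0. Qed.

Lemma varS_topS n m : varS (@topS n m).
Proof. by exists ord0. Qed.

(** The value variable must stay on top while the remaining variables are
reindexed, hence the [pushN] in the proof. *)
Lemma definable_fun_reindex n m n' m' (r : env n' m' -> env n m) (f : env n m -> nat) :
  reindexing r -> definable_fun f -> definable_fun (fun s => f (r s)).
Proof.
move=> hr hf.
have hr' : reindexing (fun s : env n'.+1 m' => r (popN s)).
  case: (hr) => -[u hu] [w hw]; split; last by exists w => s i; rewrite -hw.
  by exists (fun i => inord (u i).+1) => s i; rewrite -hu -tnth_behead.
apply: definable_ext (definable_reindex (reindexing_pushN hr' (varN_topN _ _)) hf) _.
by move=> s; rewrite topN_push popN_push.
Qed.

(** * Closure properties of definability *)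

Section Closure.
Context {n m : nat}.
Implicit Types (P Q : env n m -> Prop).

Lemma definable_not P : definable P -> definable (fun s => ~ P s).
Proof. by move=> [p hp]; exists (Not p) => s /=; rewrite hp. Qed.

Lemma definable_and P Q :
  definable P -> definable Q -> definable (fun s => P s /\ Q s).
Proof. by move=> [p hp] [q hq]; exists (And p q) => s /=; rewrite hp hq. Qed.

Lemma definable_or P Q :
  definable P -> definable Q -> definable (fun s => P s \/ Q s).
Proof. by move=> [p hp] [q hq]; exists (Or p q) => s /=; rewrite hp hq. Qed.

Lemma definable_imp P Q :
  definable P -> definable Q -> definable (fun s => P s -> Q s).
Proof. by move=> [p hp] [q hq]; exists (Imp p q) => s /=; rewrite hp hq. Qed.

Lemma definable_iff P Q :
  definable P -> definable Q -> definable (fun s => P s <-> Q s).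
Proof. by move=> hP hQ; apply: definable_and; apply: definable_imp. Qed.

Lemma definable_allN (R : env n m -> nat -> Prop) :
  definable (fun s : env n.+1 m => R (popN s) (topN s)) ->
  definable (fun s => forall k, R s k).
Proof.
move=> [p hp]; exists (AllN p) => s /=.
by split=> h k; have := h k; have := hp (pushN k s); rewrite popN_push => <-.
Qed.

Lemma definable_exN (R : env n m -> nat -> Prop) :
  definable (fun s : env n.+1 m => R (popN s) (topN s)) ->
  definable (fun s => exists k, R s k).
Proof.
move=> [p hp]; exists (ExN p) => s /=.
by split=> -[k h]; exists k; move: h; have := hp (pushN k s); rewrite popN_push => <-.
Qed.

Lemma definable_exS (R : env n m -> set nat -> Prop) :
  definable (fun s : env n m.+1 => R (popS s) (topS s)) ->
  definable (fun s => exists Y, R s Y).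
Proof.
move=> [p hp]; exists (ExS p) => s /=.
by split=> -[k h]; exists k; move: h; have := hp (pushS k s); rewrite popS_push => <-.
Qed.

End Closure.

Section Substitution.
Context {n m : nat}.
Implicit Types (f g : env n m -> nat).

(** [R s (f s)] is rewritten as [exists k, k = f s /\ R s k]: terms of the
language are only polynomials, so other functions enter through their graphs. *)
Lemma definable_subst (R : env n m -> nat -> Prop) f :
  definable_fun f -> definable (fun s : env n.+1 m => R (popN s) (topN s)) ->
  definable (fun s => R s (f s)).
Proof.
move=> hf hR.
have: definable (fun s => exists k, k = f s /\ R s k).
  by apply: definable_exN; apply: definable_and.
by move/definable_ext; apply=> s; split=> [[_ [-> //]]|h]; exists (f s).
Qed.

Lemma definable_fun_var f : varN f -> definable_fun f.
Proof.
move=> [i hi]; exists (EqN _ (Var ord0) (Var (lift ord0 i))) => s /=.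
by rewrite -{2}(pushN_pop s) tnthS hi.
Qed.

Lemma definable_eq f g :
  definable_fun f -> definable_fun g -> definable (fun s => f s = g s).
Proof. by move=> hf hg; apply: (@definable_subst (fun s k => k = g s)). Qed.

End Substitution.

Lemma definable_fun_subst n m (h : env n m -> nat -> nat) f :
  definable_fun f -> definable_fun (fun s : env n.+1 m => h (popN s) (topN s)) ->
  definable_fun (fun s => h s (f s)).
Proof.
move=> hf hh; rewrite /definable_fun.
have hf' : definable_fun (fun s : env n.+1 m => f (popN s)).
  by apply: definable_fun_reindex hf; apply/reindexing_popN/reindexing_id.
apply: (@definable_subst _ _ (fun s k => topN s = h (popN s) k)) => //.
have hr : reindexing (fun s : env n.+2 m =>
    pushN (topN (popN s)) (pushN (topN s) (popN (popN s)))).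
  apply: reindexing_pushN.
    apply: reindexing_pushN; last exact: varN_topN.
    exact/reindexing_popN/reindexing_popN/reindexing_id.
  apply: (varN_reindex _ (varN_topN _ _)); exact/reindexing_popN/reindexing_id.
apply: definable_ext (definable_reindex hr hh) _ => s.
by rewrite topN_push !popN_push topN_push.
Qed.

(** It suffices to treat a relation on variables, where it can be atomic; the
arguments are then substituted one at a time. *)
Lemma definable_rel2 (R : nat -> nat -> Prop) n m (f g : env n m -> nat) :
  (forall n m (x y : env n m -> nat), varN x -> varN y ->
     definable (fun s => R (x s) (y s))) ->
  definable_fun f -> definable_fun g -> definable (fun s => R (f s) (g s)).
Proof.
move=> hR hf hg; apply: (@definable_subst _ _ (fun s k => R k (g s))) => //.
apply: (@definable_subst _ _ (fun s k => R (topN s) k)).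
  by apply: definable_fun_reindex hg; apply/reindexing_popN/reindexing_id.
apply: hR; last exact: varN_topN.
by apply: varN_reindex (varN_topN _ _); apply/reindexing_popN/reindexing_id.
Qed.

Lemma definable_fun_op2 (F : nat -> nat -> nat) n m (f g : env n m -> nat) :
  (forall n m (x y : env n m -> nat), varN x -> varN y ->
     definable_fun (fun s => F (x s) (y s))) ->
  definable_fun f -> definable_fun g -> definable_fun (fun s => F (f s) (g s)).
Proof.
move=> hF hf hg; apply: (@definable_fun_subst _ _ (fun s k => F k (g s))) => //.
apply: (@definable_fun_subst _ _ (fun s k => F (topN s) k)).
  by apply: definable_fun_reindex hg; apply/reindexing_popN/reindexing_id.
apply: hF; last exact: varN_topN.
by apply: varN_reindex (varN_topN _ _); apply/reindexing_popN/reindexing_id.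
Qed.

Lemma definable_fun_term n m (t : term n.+1) (f : env n m -> nat) :
  (forall s, eval s.1 t = f (popN s)) -> definable_fun f.
Proof.
by move=> ht; exists (EqN _ (Var ord0) t) => s /=; rewrite ht.
Qed.

Section ArithmeticClosure.
Context {n m : nat}.
Implicit Types (f g : env n m -> nat).

Lemma definable_fun_add f g :
  definable_fun f -> definable_fun g -> definable_fun (fun s => f s + g s).
Proof.
apply: definable_fun_op2 => n' m' x y [i hi] [j hj].
apply: (definable_fun_term (t := Add (Var (lift ord0 i)) (Var (lift ord0 j)))) => s /=.
by rewrite -{1 2}(pushN_pop s) !tnthS hi hj.
Qed.

Lemma definable_fun_mul f g :
  definable_fun f -> definable_fun g -> definable_fun (fun s => f s * g s).
Proof.
apply: definable_fun_op2 => n' m' x y [i hi] [j hj].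
apply: (definable_fun_term (t := Mul (Var (lift ord0 i)) (Var (lift ord0 j)))) => s /=.
by rewrite -{1 2}(pushN_pop s) !tnthS hi hj.
Qed.

Lemma definable_fun_const c : definable_fun (fun _ : env n m => c).
Proof.
apply: (definable_fun_term (t := iter c (fun t => Add (One _) t) (Zero _))) => s.
by elim: c => //= c ->.
Qed.

Lemma definable_fun_succ f : definable_fun f -> definable_fun (fun s => (f s).+1).
Proof. by move=> hf; apply: (definable_fun_add (definable_fun_const 1) hf). Qed.

Lemma definable_lt f g :
  definable_fun f -> definable_fun g -> definable (fun s => f s < g s).
Proof.
apply: (definable_rel2 (R := fun x y => x < y)) => n' m' x y [i hi] [j hj].
by exists (Lt _ (Var i) (Var j)) => s /=; rewrite hi hj.
Qed.

Lemma definable_le f g :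
  definable_fun f -> definable_fun g -> definable (fun s => f s <= g s).
Proof. by move=> hf hg; apply: (definable_lt hf (definable_fun_succ hg)). Qed.

Lemma definable_eqb f g :
  definable_fun f -> definable_fun g -> definable (fun s => f s == g s).
Proof.
by move=> hf hg; apply: definable_ext (definable_eq hf hg) _ => s; split=> /eqP.
Qed.

Lemma definable_in f (X : env n m -> set nat) :
  varS X -> definable_fun f -> definable (fun s => f s \in X s).
Proof.
move=> [j hj] hf; apply: (definable_subst (R := fun s k => k \in X s)) => //.
exists (Defs.Mem (Var ord0) j) => s /=; rewrite hj.
by split=> [/mem_set//|/set_mem].
Qed.

Lemma definable_fun_if (b : env n m -> bool) f g :
  definable (fun s => b s) -> definable_fun f -> definable_fun g ->
  definable_fun (fun s => if b s then f s else g s).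
Proof.
move=> hb hf hg; rewrite /definable_fun.
have hb' := definable_reindex (reindexing_popN (reindexing_id n.+1 m)) hb.
have := definable_or (definable_and hb' hf) (definable_and (definable_not hb') hg).
by move/definable_ext; apply=> s; case: (b _); split=> // [[[]|[]]|]; auto.
Qed.

Lemma definable_fun_bool (b : env n m -> bool) :
  definable (fun s => b s) -> definable_fun (fun s => nat_of_bool (b s)).
Proof.
move=> hb; have := definable_fun_if hb (definable_fun_const 1) (definable_fun_const 0).
by move/definable_ext; apply=> s; case: (b _).
Qed.

End ArithmeticClosure.

(** * Quantification over functions *)

(** A polynomial pairing is expressed by a term of the language. *)
Definition pairing x y := (x + y) * (x + y) + x.

Lemma pairing_inj x y x' y' : pairing x y = pairing x' y' -> x = x' /\ y = y'.
Proof.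
rewrite /pairing => e.
suff: x + y = x' + y' by move=> h; rewrite h in e; lia.
(* The values with [x + y = u] lie from [u * u] to [u * u + u], below the next square. *)
have sq u v : u < v -> u * u + u < v * v by nia.
by case: (ltngtP (x + y) (x' + y')) => // /sq; lia.
Qed.

(** A total decoding: where the set is not the graph of a function at [x], the
value is 0.  As every function has a code, a quantifier over
functions then becomes a quantifier over sets with no side condition. *)
Definition coded_fun (X : set nat) (x : nat) : nat :=
  xget 0 [set y | forall z, pairing x z \in X <-> z = y].

Lemma coded_fun_surj (f : nat -> nat) : exists X, coded_fun X = f.
Proof.
exists [set w | exists x, w = pairing x (f x)]; apply/funext => x; rewrite /coded_fun.
case: xgetP => [y _ /= h|/(_ (f x)) []] /=.
  by apply/esym/h/mem_set; exists x.
by move=> z; split=> [/set_mem[x' /pairing_inj[-> ->]]|->] //; apply/mem_set; exists x.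
Qed.

Lemma coded_funE X x y : y = coded_fun X x <->
  (forall z, pairing x z \in X <-> z = y) \/
  (y = 0 /\ ~ exists y', forall z, pairing x z \in X <-> z = y').
Proof.
rewrite /coded_fun; case: xgetP => [w _ /= h|/= h]; split.
- by move=> ->; left.
- by case=> [h'|[_ []]]; [apply/h; rewrite h'|exists w].
- by move=> ->; right; split=> // -[y' /h].
- by case=> [/h|[]].
Qed.

Ltac reindexing_tac :=
  repeat first [apply: reindexing_popN | apply: reindexing_popS];
  exact: reindexing_id.

Ltac varS_tac :=
  lazymatch goal with
  | |- varS (fun s => topS _) =>
      apply: (varS_reindex _ (varS_topS _ _)); reindexing_tac
  | |- varS (@topS _ _) => exact: varS_topS
  | _ => match goal with
         | H : varS _ |- _ => exact: H
         | H : varS _ |- _ => apply: (varS_reindex _ H); reindexing_tac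
         end
  end.

Ltac definable_fun_leaf :=
  match goal with
  | |- definable_fun (fun s => topN _) =>
      apply: definable_fun_var; apply: (varN_reindex _ (varN_topN _ _)); reindexing_tac
  | |- definable_fun (@topN _ _) => apply: definable_fun_var; exact: varN_topN
  | H : definable_fun _ |- _ => exact: H
  | H : definable_fun _ |- _ => apply: (definable_fun_reindex _ H); reindexing_tac
  end.

(** A hook for the closure lemmas that are themselves proved by
[definability]. *)
Ltac definability_extra := fail.

Ltac definability_step :=
  cbv beta;
  lazymatch goal with
  | |- definable (fun s => _ <-> _) => apply: definable_iff
  | |- definable (fun s => _ /\ _) => apply: definable_and
  | |- definable (fun s => _ \/ _) => apply: definable_or
  | |- definable (fun s => ~ _) => apply: definable_not
  | |- definable (fun s => exists k : nat, _) => apply: definable_exN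
  | |- definable (fun s => exists X : set nat, _) => apply: definable_exS
  | |- definable (fun s => forall k : nat, _) => apply: definable_allN
  | |- definable (fun s => _ -> _) => apply: definable_imp
  | |- definable (fun s => _ = _ :> nat) => apply: definable_eq
  | |- definable (fun s => is_true (_ == _)) => apply: definable_eqb
  | |- definable (fun s => is_true (_ < _)) => apply: definable_lt
  | |- definable (fun s => is_true (_ <= _)) => apply: definable_le
  | |- definable (fun s => is_true (_ \in _)) => apply: definable_in
  | |- definable_fun (fun s => pairing _ _) => rewrite /pairing
  | |- definable_fun (fun s => _ + _) => apply: definable_fun_add
  | |- definable_fun (fun s => _ * _) => apply: definable_fun_mul
  | |- definable_fun (fun s => _.+1) =>
      first [apply: definable_fun_const | apply: definable_fun_succ]
  | |- definable_fun (fun s => if _ then _ else _) => apply: definable_fun_if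
  | |- definable_fun (fun s => nat_of_bool _) => apply: definable_fun_bool
  | |- definable_fun _ =>
      first [definability_extra | apply: definable_fun_const | definable_fun_leaf]
  | |- varS _ => varS_tac
  | |- _ => definability_extra
  end.

Ltac definability := repeat definability_step.

Lemma definable_fun_coded n m (X : env n m -> set nat) f :
  varS X -> definable_fun f -> definable_fun (fun s => coded_fun (X s) (f s)).
Proof.
move=> hX hf; rewrite /definable_fun.
have: definable (fun s : env n.+1 m =>
  (forall z, pairing (f (popN s)) z \in X (popN s) <-> z = topN s) \/
  (topN s = 0 /\ ~ exists y', forall z,
     pairing (f (popN s)) z \in X (popN s) <-> z = y')).
  by definability.
by move/definable_ext; apply=> s; rewrite -coded_funE.
Qed.

Lemma definable_exF n m (R : env n m -> (nat -> nat) -> Prop) :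
  definable (fun s : env n m.+1 => R (popS s) (coded_fun (topS s))) ->
  definable (fun s => exists f, R s f).
Proof.
move=> hR; apply: definable_ext (definable_exS (R := fun s X => R s (coded_fun X)) hR) _.
move=> s; split=> [[X h]|[f h]]; first by exists (coded_fun X).
by have [X XE] := coded_fun_surj f; exists X; rewrite XE.
Qed.

Lemma coded_fun2_surj (f : nat -> nat -> nat) :
  exists X, (fun x y => coded_fun X (pairing x y)) = f.
Proof.
have [X XE] := coded_fun_surj (fun w =>
  xget 0 [set v | exists x y, w = pairing x y /\ v = f x y]).
exists X; apply/funext => x; apply/funext => y; rewrite XE.
case: xgetP => [_ -> [x' [y' [/pairing_inj[-> ->] ->]]]//|/(_ (f x y)) []].
by exists x, y.
Qed.

Lemma definable_exF2 n m (R : env n m -> (nat -> nat -> nat) -> Prop) :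
  definable (fun s : env n m.+1 =>
    R (popS s) (fun x y => coded_fun (topS s) (pairing x y))) ->
  definable (fun s => exists f, R s f).
Proof.
move=> /(definable_exS (R := fun s X => R s (fun x y => coded_fun X (pairing x y)))) hR.
apply: definable_ext hR _ => s; split=> [[X h]|[f h]].
  by exists (fun x y => coded_fun X (pairing x y)).
by have [X XE] := coded_fun2_surj f; exists X; rewrite XE.
Qed.

(** The model for all recursions below: the value is that of some function
satisfying the recursion equations. *)
Lemma definable_fun_pow2 n m (f : env n m -> nat) :
  definable_fun f -> definable_fun (fun s => 2 ^ f s).
Proof.
move=> hf; rewrite /definable_fun.
have: definable (fun s : env n.+1 m => exists h : nat -> nat,
    h 0 = 1 /\ (forall i, h i.+1 = 2 * h i) /\ topN s = h (f (popN s))).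
  by apply: definable_exF; definability; apply: definable_fun_coded; definability.
move/definable_ext; apply=> s; split=> [[h [h0 [hS ->]]]|->].
  by elim: (f _) => // i IH; rewrite hS IH expnS.
by exists (fun i => 2 ^ i); split=> //; split=> // i; rewrite expnS.
Qed.

Ltac definability_extra ::=
  lazymatch goal with
  | |- definable (fun s => exists f : nat -> nat, _) => apply: definable_exF
  | |- definable (fun s => exists f : nat -> nat -> nat, _) => apply: definable_exF2
  | |- definable_fun (fun s => coded_fun _ _) => apply: definable_fun_coded
  | |- definable_fun (fun s => 2 ^ _) => apply: definable_fun_pow2
  end.

(** * Definability of computation *)

Definition mkinstr (o x y z : nat) : instr :=
  if o == 0 then Zeroing x else
  if o == 1 then Succ x else
  if o == 2 then Transfer x y else
  if o == 3 then Jump x y z else Query x.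

Lemma mkinstr_surj i : exists o x y z, mkinstr o x y z = i.
Proof.
case: i => [x|x|x y|x y z|x].
- by exists 0, x, 0, 0.
- by exists 1, x, 0, 0.
- by exists 2, x, y, 0.
- by exists 3, x, y, z.
- by exists 4, x, 0, 0.
Qed.

(** Programs are presented by a length and four functions on instruction
addresses, so that a quantifier over programs becomes quantifiers over numbers
and functions. *)
Definition mkprog (l : nat) (o x y z : nat -> nat) : seq instr :=
  mkseq (fun i => mkinstr (o i) (x i) (y i) (z i)) l.

Lemma mkprog_surj p : exists l o x y z, mkprog l o x y z = p.
Proof.
elim: p => [|i p [l [o [x [y [z <-]]]]]]; first by exists 0, id, id, id, id.
have [o0 [x0 [y0 [z0 <-]]]] := mkinstr_surj i.
pose cons (a : nat) (f : nat -> nat) j := if j is j'.+1 then f j' else a.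
exists l.+1, (cons o0 o), (cons x0 x), (cons y0 y), (cons z0 z).
by rewrite /mkprog /mkseq /= (iotaDl 1 0) -map_comp.
Qed.

(** The code of a list with head [n] and with a tail coded by [m]; the empty
list has code 0. *)
Definition code_cons (n m : nat) : nat := 2 ^ n * (2 * m).+1.

Lemma code_seq_cons n s : CodeSeq.code (n :: s) = code_cons n (CodeSeq.code s).
Proof. by rewrite /code_cons mul2n. Qed.

(** Every operation code from 4 on denotes a query, whose tag is 4. *)
Definition code_mkinstr (o x y z : nat) : nat :=
  code_cons (if o < 4 then o else 4)
    (code_cons x
      (if o == 2 then code_cons y 0 else
       if o == 3 then code_cons y (code_cons z 0) else 0)).

Lemma code_mkinstrE o x y z : code_instr (mkinstr o x y z) = code_mkinstr o x y z.
Proof.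
by case: o => [|[|[|[|o]]]]; rewrite /code_mkinstr /code_cons /code_instr /=
  !mul2n ?mul1n ?muln1; lia.
Qed.

(** The function [g] lists the codes of the suffixes, from the whole list down
to the empty one. *)
Lemma code_mkseq (f : nat -> nat) l e : CodeSeq.code (mkseq f l) = e <->
  exists g : nat -> nat, g 0 = e /\ g l = 0 /\
    forall i, i < l -> g i = code_cons (f i) (g i.+1).
Proof.
split=> [<-|[g [<- [gl gS]]]].
  exists (fun i => CodeSeq.code (drop i (mkseq f l))); rewrite drop0; split=> //.
  rewrite drop_oversize ?size_mkseq //; split=> // i il.
  by rewrite (drop_nth 0) ?size_mkseq // nth_mkseq // code_seq_cons.
(* Induction from the end of the list, on the length of the suffix. *)
suff h d i : i + d = l -> CodeSeq.code (map f (iota i d)) = g i by apply: (h l 0).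
elim: d i => [|d IH] i; first by rewrite addn0 => ->.
move=> hd; rewrite gS -?IH -?code_seq_cons // -?hd; lia.
Qed.

(** The two components of one machine step, as arithmetical case
distinctions. *)
Definition next_pc (l : nat) (o x y z : nat -> nat) (pc : nat) (r : nat -> nat) :=
  if pc < l then
    if o pc == 3 then if r (x pc) == r (y pc) then z pc else pc.+1 else pc.+1
  else pc.

Definition next_reg (a : set nat) (l : nat) (o x y : nat -> nat) (pc : nat)
    (r : nat -> nat) (i : nat) :=
  if pc < l then
    if o pc == 3 then r i else
    if i == (if o pc == 2 then y pc else x pc) then
      if o pc == 0 then 0 else
      if o pc == 1 then (r (x pc)).+1 else
      if o pc == 2 then r (x pc) else nat_of_bool (r (x pc) \in a)
    else r i
  else r i.

Lemma step_mkprog a l o x y z pc r : step a (mkprog l o x y z) (pc, r) =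
  (next_pc l o x y z pc r, next_reg a l o x y pc r).
Proof.
rewrite /step /next_pc.
have [lt|le] := ltnP pc l; last first.
  rewrite onth_default ?size_mkseq //; congr pair; apply/funext => i.
  by rewrite /next_reg ltnNge le.
have -> : onth (mkprog l o x y z) pc = Some (mkinstr (o pc) (x pc) (y pc) (z pc)).
  by rewrite /mkprog onthE (nth_map (Zeroing 0)) ?size_mkseq // nth_mkseq.
rewrite /mkinstr.
have E b r1 r2 : r1 =1 r2 -> (b, r1) = (b, r2) :> config by move=> /funext ->.
by case oE: (o pc) => [|[|[|[|o']]]]; apply: E => i; rewrite /next_reg lt oE.
Qed.

(** The function [g] checks that [e] codes the program, while [pc] and [r] are
the full history of the run; the right-hand side uses only operations under
which definability is closed. *)
Lemma PhiE e a n m : Phi e a n m <->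
  exists l, exists o x y z : nat -> nat,
    (exists g : nat -> nat, g 0 = e /\ g l = 0 /\ forall i, i < l ->
       g i = code_cons (code_mkinstr (o i) (x i) (y i) (z i)) (g i.+1)) /\
    exists (pc : nat -> nat) (r : nat -> nat -> nat),
      pc 0 = 0 /\ (forall i, r 0 i = if i == 0 then n else 0) /\
      (forall t, pc t.+1 = next_pc l o x y z (pc t) (r t) /\
         forall i, r t.+1 i = next_reg a l o x y (pc t) (r t) i) /\
      exists t, l <= pc t /\ r t 0 = m.
Proof.
have codeE l o x y z : code_prog (mkprog l o x y z) = CodeSeq.code
    (mkseq (fun i => code_mkinstr (o i) (x i) (y i) (z i)) l).
  by rewrite /code_prog /mkprog /mkseq -map_comp; congr CodeSeq.code;
    apply: eq_map => i /=; rewrite code_mkinstrE.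
split=> [[p]|[l [o [x [y [z []]]]]]].
  have [l [o [x [y [z <-]]]]] := mkprog_surj p.
  rewrite codeE => pe [T []]; rewrite size_mkseq => hl hm.
  exists l, o, x, y, z; split; first exact/code_mkseq.
  pose st t := iter t (step a (mkprog l o x y z)) (init n).
  exists (fun t => (st t).1), (fun t => (st t).2); split=> //; split=> //.
  split; last by exists T.
  move=> t; have -> : st t.+1 = step a (mkprog l o x y z) (st t) by [].
  by case: (st t) => pc r; rewrite step_mkprog.
move/code_mkseq; rewrite -codeE => pe [pc [r [pc0 [r0 [hS [t [lt hm]]]]]]].
exists (mkprog l o x y z) => //; exists t.
suff -> : iter t (step a (mkprog l o x y z)) (init n) = (pc t, r t).
  by rewrite size_mkseq.
elim: t {lt hm} => [|t IH].
  by rewrite pc0 /init; congr pair; apply/funext => i; rewrite r0.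
rewrite iterS IH step_mkprog; have [-> hr] := hS t.
by congr pair; apply/funext => i; rewrite hr.
Qed.

Lemma definable_Phi n m (e x y : env n m -> nat) (a : env n m -> set nat) :
  definable_fun e -> varS a -> definable_fun x -> definable_fun y ->
  definable (fun s => Phi (e s) (a s) (x s) (y s)).
Proof.
move=> he ha hx hy.
apply: definable_ext; last by move=> s; apply: iff_sym; apply: PhiE.
rewrite /next_pc /next_reg /code_mkinstr /code_cons.
by definability.
Qed.

Lemma definable_Phi_graph e n m (X Y : env n m -> set nat) :
  varS X -> varS Y ->
  definable (fun s => forall i, Phi e (X s) i (nat_of_bool (i \in Y s))).
Proof. by move=> hX hY; definability; apply: definable_Phi; definability. Qed.

Lemma definable_jump n m (X Y : env n m -> set nat) :
  varS X -> varS Y -> definable (fun s => X s = jump (Y s)).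
Proof.
move=> hX hY.
have: definable (fun s => forall e, e \in X s <-> exists i, Phi e (Y s) e i).
  by definability; apply: definable_Phi; definability.
move/definable_ext; apply=> s; split=> [h|-> e].
  by apply/seteqP; split=> e; [move/mem_set/h|move=> /h/set_mem].
by split=> [/set_mem|h]; last exact/mem_set.
Qed.

(** * Transfer of typicality along definable functions *)

(** The formula [exists x, phi x c /\ G x y] in [y] defines the image under [G]
of the set defined by [phi]; a surjection onto a set of size continuum can only
come from a set of reals of size continuum. *)
Lemma Tp_transfer k (c : k.-tuple (set nat)) (G : set nat -> set nat -> Prop) a b :
  (forall n m (X Y : env n m -> set nat), varS X -> varS Y ->
     definable (fun s => G (X s) (Y s))) ->
  (forall x y y', G x y -> G x y' -> y = y') ->
  G a b -> Tp b c -> Tp a c.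
Proof.
move=> Gdef Gfun Gab Tb phi phia.
have [psi hpsi] : definable (fun s : env 0 k.+1 =>
    exists x, sat phi s.1 [tuple of x :: (popS s).2] /\ G x (topS s)).
  apply: definable_exS; apply: definable_and; last first.
    apply: Gdef; first exact: varS_topS.
    by varS_tac.
  have hr : reindexing (fun s : env 0 k.+2 => pushS (topS s) (popS (popS s))).
    by apply: reindexing_pushS; [reindexing_tac|exact: varS_topS].
  by apply: (definable_reindex hr (P := fun s => sat phi s.1 s.2)); exists phi.
have psiE y : definable_set psi c y <-> exists x, definable_set phi c x /\ G x y.
  rewrite /definable_set /= (hpsi ([tuple], [tuple of y :: c])).
  by rewrite -[(_, [tuple of y :: c])]/(pushS y ([tuple], c)) popS_push topS_push.
have psi_full : definable_set psi c #= [set: set nat].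
  by apply: Tb; apply/psiE; exists a.
rewrite card_eq_le subset_card_le ?andTb; last by [].
move: psi_full; rewrite card_eq_le => /andP[_ /card_le_trans]; apply.
pose g x := xget set0 [set y | G x y].
apply: card_le_trans (card_image_le g (definable_set phi c)).
apply: subset_card_le => y /psiE[x [hx Gxy]]; exists x => //.
exact: Gfun (xgetPex set0 (ex_intro _ y Gxy)) Gxy.
Qed.

Lemma Tp_turing_le k (c : k.-tuple (set nat)) a b :
  turing_le b a -> Tp b c -> Tp a c.
Proof.
move=> [e he]; apply: (Tp_transfer (G := fun x y =>
  forall i, Phi e x i (nat_of_bool (i \in y)))) => //.
  by move=> n m X Y; apply: definable_Phi_graph.
move=> x y y' h h'; apply/seteqP; split=> i /mem_set yi; apply: set_mem.
  by have := Phi_functional (h i) (h' i); rewrite yi; case: (i \in y').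
by have := Phi_functional (h i) (h' i); rewrite yi; case: (i \in y).
Qed.

(** * The jump is injective *)

(** Both register 1, the counter, and register 2, which stays 0, start at 0
whatever the input.  The final jump leads to itself, so it loops when the query
answers 0 and lets the machine halt otherwise. *)
Definition tester (n : nat) : seq instr :=
  nseq n (Succ 1) ++ [:: Query 1; Jump 1 2 n.+1].

Lemma tester_run a n x : exists r : nat -> nat,
  iter n.+1 (step a (tester n)) (init x) = (n.+1, r) /\
  r 1 = nat_of_bool (n \in a) /\ r 2 = 0.
Proof.
have run t : t <= n -> exists r : nat -> nat,
    iter t (step a (tester n)) (init x) = (t, r) /\ r 1 = t /\ r 2 = 0.
  elim: t => [|t IH] tn; first by exists (init x).2.
  have [r [rE [r1 r2]]] := IH (ltnW tn).
  exists (set_reg r 1 (r 1).+1); rewrite iterS rE /set_reg /= r1; split=> //.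
  by rewrite /step onth_cat size_nseq tn onth_nseq tn r1.
have [r [rE [r1 r2]]] := run n (leqnn n).
exists (set_reg r 1 (nat_of_bool (n \in a))); split=> //.
by rewrite iterS rE /step onth_cat size_nseq ltnn subnn /= r1.
Qed.

Lemma jump_tester a n : jump a (code_prog (tester n)) <-> a n.
Proof.
set e := code_prog _; have [r [rE [r1 r2]]] := tester_run a n e.
have next : step a (tester n) (n.+1, r) = (if n \in a then n.+2 else n.+1, r).
  rewrite /step onth_cat size_nseq ltnNge leqnSn subSnn /= r1 r2.
  by case: (n \in a).
have sz : size (tester n) = n.+2 by rewrite size_cat size_nseq addn2.
split=> [[m [p /code_prog_inj -> [t [ht _]]]]|/mem_set na]; last first.
  exists (r 0), (tester n) => //; exists n.+2.
  by rewrite iterS rE next na sz.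
apply: set_mem; apply: contraPT ht => na.
(* The run is caught at address [n.+1], and it would stay halted once halted. *)
have stuck u : iter (u + n.+1) (step a (tester n)) (init e) = (n.+1, r).
  by elim: u => [|u IH]; rewrite ?add0n // addSn iterS IH next (negbTE na).
have stop u : size (tester n) <= (iter t (step a (tester n)) (init e)).1 ->
    iter (u + t) (step a (tester n)) (init e) = iter t (step a (tester n)) (init e).
  move=> ht; elim: u => // u IH; rewrite addSn iterS IH.
  by move: ht; case: (iter t _ _) => pc q /= ht; rewrite onth_default.
move=> ht; have := stop n.+1 ht; rewrite addnC stuck => E.
by move: ht; rewrite -E sz /= ltnn.
Qed.

Lemma jump_inj : injective jump.
Proof.
by move=> a b E; apply/seteqP; split=> n /jump_tester h; apply/jump_tester;
  [rewrite -E|rewrite E].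
Qed.

(** * Typicality, Turing reducibility and the jump *)

Theorem theorem3p10 (a b : set nat) (k : nat) (c : k.-tuple (set nat)) :
  [/\ (~ Tp a c -> turing_le b a -> ~ Tp b c) /\
      (Tp b c -> turing_le b a -> Tp a c),
      Tp a c -> turing_eq b a -> Tp b c
    & Tp a c <-> Tp (jump a) c].
Proof.
split; first split.
- by move=> nTa ba Tb; apply/nTa/(Tp_turing_le ba).
- by move=> Tb ba; apply: Tp_turing_le ba Tb.
- by move=> Ta [_ ab]; apply: Tp_turing_le ab Ta.
split.
  apply: (Tp_transfer (G := fun x y => x = jump y)) => //.
    by move=> n m X Y; apply: definable_jump.
  by move=> x y y' -> /jump_inj.
apply: (Tp_transfer (G := fun x y => y = jump x)) => //.
  by move=> n m X Y hX hY; apply: definable_jump.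
by move=> x y y' -> ->.
Qed.
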